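(* For every positive integer $r$, \[ \sum_{n=1}^\infty \frac{\bar H_{2n}\,\zeta_{n-1}(\{2\}_{r-1})}{n^2}=\sum_{j=1}^{r}(-1)^{j}(1-4^{-j})\,\zeta(\{2\}_{r-j})\,\zeta(2j+1), \] where $\zeta(\{2\}_m)=\frac{\pi^{2m}}{(2m+1)!}$ for $m\ge1$ and $\zeta(\{2\}_0)=1$.
   Context: $\bar H_{2n}:=\sum_{j=1}^{2n}\frac{(-1)^j}{j}$. For a nonnegative integer $n$ and a tuple $(k_1,\ldots,k_m)$ of positive integers, the multiple harmonic sum is $\zeta_n(k_1,\ldots,k_m):=\sum_{n\ge n_1>\cdots>n_m>0}\frac{1}{n_1^{k_1}\cdots n_m^{k_m}}$, with $\zeta_n(k_1,\ldots,k_m):=0$ if $n<m$ and $\zeta_n(\emptyset):=1$. The multiple zeta value is $\zeta(k_1,\ldots,k_m):=\lim_{n\to\infty}\zeta_n(k_1,\ldots,k_m)$ (for $k_1>1$), with $\zeta(\emptyset)=1$. $\{2\}_m$ denotes $2,\ldots,2$ with $m$ repetitions (empty if $m=0$). $\zeta(s)$ for a single argument is the Riemann zeta value. *)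

(* Defs.v *)
From Stdlib Require Import Reals List Lia.
From Coquelicot Require Import Coquelicot.
Open Scope R_scope.

(* Alternating harmonic number with the sign (-1)^j, so that Hbar 1 = -1. *)
Definition Hbar (N : nat) : R :=
  sum_n_m (fun j => (-1) ^ j / INR j) 1 N.

(* sum over n >= n_1 > ... > n_m > 0, nested with n_1 outermost;
   sum_n_m over an empty range is 0. *)
Fixpoint mhs (n : nat) (ks : list nat) : R :=
  match ks with
  | nil => 1
  | k :: ks' => sum_n_m (fun n1 => / INR n1 ^ k * mhs (n1 - 1) ks') 1 n
  end.

Lemma mhs_small (ks : list nat) (n : nat) : (n < length ks)%nat -> mhs n ks = 0.
Proof.
revert n; induction ks as [|k ks IH]; simpl; intros n Hn; [lia|].
rewrite (sum_n_m_ext_loc _ (fun _ => 0)).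
- apply (sum_n_m_const_zero (G := R_AbelianMonoid)).
- intros i Hi; rewrite IH by lia; apply Rmult_0_r.
Qed.

(* Only meaningful for ks empty or with head at least 2; Lim_seq is total. *)
Definition mzv (ks : list nat) : R := real (Lim_seq (fun n => mhs n ks)).

Definition riemann_zeta (s : nat) : R := Series (fun i => / INR (S i) ^ s).

Definition twos (m : nat) : list nat := repeat 2%nat m.

(* Main.v *)
(** Write [e_n(i)] for the multiple harmonic sum of [{2}_i] truncated at [n], with
    generating polynomial [prod_(k <= n) (1 + X / k^2)].

    Let [g_n(j) = sum_(k = 1)^n (-1)^(k-1) rho_(n,k) / k^(2j+1)] with
    [rho_(n,k) = n!^2 / ((n-k)! (n+k)!)]. From [rho_(n-1,k) = (1 - k^2/n^2) rho_(n,k)] one gets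
    [g_(n-1)(j+1) = g_n(j+1) - g_n(j) / n^2], and [g_n(0)] is minus the alternating harmonic
    number. Comparing with the recurrence of [e_n], the [N]-th partial sum of the series is exactly
    [sum_(j = 1)^r (-1)^j g_N(j) e_N(r-j)]. As [rho_(N,k)] tends to [1], [g_N(j)] tends to
    [sum_k (-1)^(k-1) / k^(2j+1) = (1 - 4^(-j)) zeta(2j+1)].

    The values [zeta({2}_m)] come from the same convolution argument: the normalized moments
    [b_n(j) = 4^j / (2j)! * int t^(2j) cos^(2n) t / int cos^(2n) t] on [[0, pi/2]] satisfy
    [b_(n-1)(j+1) = b_n(j+1) + b_n(j) / n^2], so [sum_j b_n(j) e_n(m-j)] does not depend on [n],
    while [b_n(j)] tends to [0] for [j > 0]. *)

Require Import Defs.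
From Stdlib Require Import Reals List Factorial Lra Lia.
From Coquelicot Require Import Coquelicot.
Open Scope R_scope.

(* Coquelicot's sums are equations in [AbelianMonoid.sort _], which [ring] and [field] reject. *)
Local Ltac eqR := match goal with |- @eq _ ?a ?b => change (@eq R a b) end.

(** * Multiple harmonic sums of [{2}_m] and convolutions *)

Lemma mhs_twos_S (n m : nat) :
  mhs (S n) (twos (S m)) = mhs n (twos (S m)) + / INR (S n) ^ 2 * mhs n (twos m).
Proof.
change (twos (S m)) with (2%nat :: twos m); cbn [mhs].
rewrite sum_n_Sm by lia.
replace (S n - 1)%nat with n by lia; reflexivity.
Qed.

Lemma mhs_twos_0 (m : nat) : mhs 0 (twos (S m)) = 0.
Proof. apply mhs_small; simpl; lia. Qed.

Lemma mhs_twos_ge0 (n m : nat) : 0 <= mhs n (twos m).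
Proof.
revert n; induction m as [|m IHm]; intros n; [simpl; lra|].
induction n as [|n IHn]; [rewrite mhs_twos_0; lra|].
rewrite mhs_twos_S; specialize (IHm n).
assert (0 < / INR (S n) ^ 2) by (apply Rinv_0_lt_compat, pow_lt, lt_0_INR; lia).
nra.
Qed.

Definition conv (b e : nat -> R) (s : nat) : R :=
  sum_f_R0 (fun j => b j * e (s - j)%nat) s.

(* In generating functions: if [e' = (1 + q X) e] and, up to the constant term,
   [b = (1 + q X) b'], then [b' e' = b e] up to a multiple of [e]. *)
Lemma conv_transfer (q : R) (e e' b b' : nat -> R) (s : nat) :
  e' 0%nat = e 0%nat ->
  (forall i, e' (S i) = e (S i) + q * e i) ->
  (forall j, b (S j) = b' (S j) + q * b' j) ->
  conv b' e' s = conv b e s + (b' 0%nat - b 0%nat) * e s.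
Proof.
intros He0 HeS HbS; unfold conv; destruct s as [|s].
- simpl; rewrite He0; ring.
- rewrite (tech5 (fun j => b' j * e' (S s - j)%nat)).
  rewrite (sum_eq _ (fun j => b' j * e (S s - j)%nat + b' j * e (s - j)%nat * q)).
  2:{ intros j Hj; replace (S s - j)%nat with (S (s - j)) by lia; rewrite HeS; ring. }
  rewrite sum_plus, <- scal_sum.
  rewrite (decomp_sum (fun j => b j * e (S s - j)%nat)) by lia; simpl pred.
  rewrite (sum_eq (fun j => b (S j) * e (S s - S j)%nat)
             (fun j => b' (S j) * e (S s - S j)%nat + b' j * e (s - j)%nat * q)).
  2:{ intros j Hj; simpl (S s - S j)%nat; rewrite HbS; ring. }
  rewrite sum_plus, <- scal_sum.
  (* Both sides contain the sum of [b' j * e (S s - j)], one without its last term and one without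
     its first; [D] equates the two ways of cutting it. *)
  pose proof (decomp_sum (fun j => b' j * e (S s - j)%nat) (S s) ltac:(lia)) as D.
  rewrite tech5 in D; simpl pred in D; cbv beta in D.
  replace (S s - S s)%nat with 0%nat in * by lia.
  replace (S s - 0)%nat with (S s) in * by lia.
  rewrite He0; lra.
Qed.

Lemma conv_split (b e : nat -> R) (s : nat) :
  conv b e s = b 0%nat * e s + sum_n_m (fun j => b j * e (s - j)%nat) 1 s.
Proof.
unfold conv; rewrite <- sum_n_Reals; unfold sum_n.
rewrite sum_Sn_m by lia; change plus with Rplus; now rewrite Nat.sub_0_r.
Qed.

(** * The ratios [rho] and the damped alternating sums *)

(* For [x = n] a natural number this is [n!^2 / ((n - k)! (n + k)!)]. *)
Fixpoint rho (x : R) (k : nat) : R :=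
  match k with
  | O => 1
  | S k' => rho x k' * ((x - INR k') / (x + INR k' + 1))
  end.

Lemma rho_shift (x : R) (k : nat) : 1 <= x ->
  rho (x - 1) k = rho x k * (1 - INR k ^ 2 / x ^ 2).
Proof.
intros Hx; induction k as [|k IH]; [simpl; field; lra|].
pose proof (pos_INR k); cbn [rho]; rewrite IH, S_INR; field; repeat split; nra.
Qed.

Lemma rho_vanish (n : nat) : rho (INR n) (S n) = 0.
Proof. cbn [rho]; unfold Rdiv; rewrite Rminus_diag; ring. Qed.

(** Each new factor is [1 - (2k+1)/(n+k+1)], which loses at most [(2k+1)/n]; these losses are
    consecutive differences of [k^2/n]. *)
Lemma rho_bounds (n k : nat) : (0 < n)%nat -> (k <= n)%nat ->
  0 <= rho (INR n) k <= 1 /\ 1 - INR k ^ 2 / INR n <= rho (INR n) k.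
Proof.
intros Hn; apply lt_0_INR in Hn; induction k as [|k IH]; intros Hk.
- simpl; split; [lra|]; unfold Rdiv; rewrite !Rmult_0_l; lra.
- destruct IH as [[H0 H1] H2]; [lia|].
  apply le_INR in Hk; rewrite S_INR in *; pose proof (pos_INR k) as Hk0.
  cbn [rho]; set (x := INR n) in *; set (y := INR k) in *.
  assert (Hq : (x - y) / (x + y + 1) = 1 - (2 * y + 1) / (x + y + 1))
    by (field; lra).
  assert (Hd : 0 <= (2 * y + 1) / (x + y + 1) <= (2 * y + 1) / x).
  { split; [apply Rdiv_le_0_compat; lra|].
    apply Rmult_le_compat_l; [lra|]; apply Rinv_le_contravar; lra. }
  assert (0 <= (x - y) / (x + y + 1)) by (apply Rdiv_le_0_compat; lra).
  replace ((y + 1) ^ 2 / x) with (y ^ 2 / x + (2 * y + 1) / x) by (field; lra).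
  split; [split; nra|nra].
Qed.

(* Gosper summation: the tails of the alternating sum are multiples of [rho]. *)
Lemma rho_alternating_sum (n : nat) : (0 < n)%nat ->
  sum_n_m (fun k => - (-1) ^ k * INR k * rho (INR n) k) 1 n
  = INR n / (2 * (2 * INR n - 1)).
Proof.
intros Hn; assert (H1 : 1 <= INR n) by (apply (le_INR 1); lia).
(* The subtracted term cancels the constant at [K = 0]; at [K = n] it contains
   [rho (INR n) (S n) = 0]. *)
assert (H : forall K,
  sum_n_m (fun k => - (-1) ^ k * INR k * rho (INR n) k) 1 K
  = INR n / (2 * (2 * INR n - 1))
    - (-1) ^ K * (INR n + INR K + 1) * (INR K + / 2) / (2 * INR n - 1) * rho (INR n) (S K)).
{ induction K as [|K IH].
  - rewrite sum_n_m_zero by lia; change (zero (G := R_AbelianMonoid)) with 0; eqR; simpl; field; lra.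
  - rewrite sum_n_Sm by lia; rewrite IH; change plus with Rplus.
    cbn [rho]; rewrite S_INR; pose proof (pos_INR K); simpl pow; eqR; field; repeat split; lra. }
rewrite H, rho_vanish; eqR; ring.
Qed.

(** The [g_n(j)] of the overview: a partial sum of the alternating zeta series at [2 * j + 1],
    damped by [rho]. *)
Definition eta_approx (n j : nat) : R :=
  sum_n_m (fun k => - (-1) ^ k * rho (INR n) k / INR k ^ (2 * j + 1)) 1 n.

Lemma sum_n_m_lin (u v : nat -> R) (q : R) (a b : nat) :
  sum_n_m (fun k => u k + q * v k) a b = sum_n_m u a b + q * sum_n_m v a b.
Proof.
rewrite (sum_n_m_plus (G := R_AbelianMonoid) u (fun k => q * v k)).
now rewrite (sum_n_m_mult_l (K := R_Ring) q v).
Qed.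

(** The added term vanishes by [rho_vanish], so that consecutive values of [n] can be compared over
    one range. *)
Lemma eta_approx_widen (n j : nat) :
  eta_approx n j
  = sum_n_m (fun k => - (-1) ^ k * rho (INR n) k / INR k ^ (2 * j + 1)) 1 (S n).
Proof.
unfold eta_approx; rewrite sum_n_Sm by lia; rewrite rho_vanish.
unfold Rdiv; rewrite Rmult_0_r, Rmult_0_l; symmetry; apply Rplus_0_r.
Qed.

Lemma rho_step (n k : nat) :
  rho (INR n) k = rho (INR (S n)) k * (1 - INR k ^ 2 / INR (S n) ^ 2).
Proof.
rewrite <- rho_shift by (apply (le_INR 1); lia).
rewrite S_INR; f_equal; ring.
Qed.

Lemma eta_approx_step (n j : nat) :
  eta_approx n (S j) = eta_approx (S n) (S j) + (- / INR (S n) ^ 2) * eta_approx (S n) j.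
Proof.
rewrite eta_approx_widen; unfold eta_approx; rewrite <- sum_n_m_lin.
apply sum_n_m_ext_loc; intros k Hk; rewrite rho_step.
assert (INR k <> 0) by (apply not_0_INR; lia).
assert (INR (S n) <> 0) by (apply not_0_INR; lia).
replace (2 * S j + 1)%nat with (2 + (2 * j + 1))%nat by lia; rewrite (pow_add (INR k) 2).
eqR; field; repeat split; auto; apply pow_nonzero; auto.
Qed.

Lemma Hbar_even_step (n : nat) :
  Hbar (2 * S n) = Hbar (2 * n) - / ((2 * INR n + 1) * (2 * INR n + 2)).
Proof.
unfold Hbar; replace (2 * S n)%nat with (S (S (2 * n))) by lia.
rewrite !sum_n_Sm by lia; change plus with Rplus.
rewrite !S_INR, mult_INR, <- !tech_pow_Rmult, pow_1_even; simpl (INR 2).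
pose proof (pos_INR n); eqR; field; lra.
Qed.

Lemma eta_approx_0 (n : nat) : eta_approx n 0 = - Hbar (2 * n).
Proof.
induction n as [|n IH].
- unfold eta_approx, Hbar; rewrite !sum_n_m_zero by lia; symmetry; apply Ropp_0.
- rewrite Hbar_even_step.
  replace (- (Hbar (2 * n) - / ((2 * INR n + 1) * (2 * INR n + 2))))
    with (eta_approx n 0 + / ((2 * INR n + 1) * (2 * INR n + 2))) by (rewrite IH; ring).
  rewrite (eta_approx_widen n); unfold eta_approx.
  (* By [rho_step], passing from [n] to [S n] adds [k^2 / (S n)^2] times the term; at [j = 0] this
     leaves a power [k] in the numerator, the sum evaluated by [rho_alternating_sum]. *)
  rewrite (sum_n_m_ext_loc _ (fun k => - (-1) ^ k * rho (INR n) k / INR k ^ (2 * 0 + 1)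
     + / INR (S n) ^ 2 * (- (-1) ^ k * INR k * rho (INR (S n)) k))).
  + rewrite sum_n_m_lin, rho_alternating_sum by lia.
    f_equal; rewrite S_INR; pose proof (pos_INR n); eqR; field; lra.
  + intros k Hk; rewrite (rho_step n k).
    assert (INR k <> 0) by (apply not_0_INR; lia).
    assert (INR (S n) <> 0) by (apply not_0_INR; lia).
    simpl (2 * 0 + 1)%nat; eqR; field; auto.
Qed.

(* Summation by parts, with [eta_approx n 0 = - Hbar (2 * n)] absorbing the boundary term. *)
Lemma partial_sum_closed_form (r n : nat) :
  sum_n_m (fun k => Hbar (2 * k) * mhs (k - 1) (twos r) / INR k ^ 2) 1 n
  = sum_n_m (fun j => (-1) ^ j * eta_approx n j * mhs n (twos (S r - j))) 1 (S r).
Proof.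
(* The sign turns the minus in [eta_approx_step] into the plus required by [conv_transfer]. *)
set (b := fun n j => (-1) ^ j * eta_approx n j).
set (e := fun n i => mhs n (twos i)).
assert (Hsplit : sum_n_m (fun j => b n j * e n (S r - j)%nat) 1 (S r)
                 = conv (b n) (e n) (S r) + Hbar (2 * n) * e n (S r)).
{ rewrite conv_split; change (b n 0%nat) with (1 * eta_approx n 0).
  rewrite eta_approx_0; symmetry; eqR; ring. }
change (sum_n_m (fun k => Hbar (2 * k) * mhs (k - 1) (twos r) / INR k ^ 2) 1 n
  = sum_n_m (fun j => b n j * e n (S r - j)%nat) 1 (S r)).
rewrite Hsplit; clear Hsplit; induction n as [|n IH].
- rewrite sum_n_m_zero by lia; change (zero (G := R_AbelianMonoid)) with 0.
  unfold conv, e; rewrite mhs_twos_0, Rmult_0_r, Rplus_0_r.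
  symmetry; apply sum_eq_R0; intros j Hj.
  unfold b, eta_approx; rewrite sum_n_m_zero by lia.
  change (zero (G := R_AbelianMonoid)) with 0; eqR; ring.
- rewrite sum_n_Sm by lia; rewrite IH; change plus with Rplus.
  rewrite (conv_transfer (/ INR (S n) ^ 2) (e n) (e (S n)) (b n) (b (S n))).
  (* The correction [b (S n) 0 - b n 0] is [Hbar (2 * n) - Hbar (2 * S n)]; against the boundary
     terms only the new summand of the series survives. *)
  + unfold b, e; rewrite !eta_approx_0, mhs_twos_S, (Hbar_even_step n).
    replace (S n - 1)%nat with n by lia; simpl pow; unfold Rdiv; eqR; ring.
  + reflexivity.
  + intros i; apply mhs_twos_S.
  + intros j; unfold b; rewrite eta_approx_step; simpl pow; ring.
Qed.

(** * Moments of even powers of the cosine *)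

Definition cos_moment (n j : nat) : R :=
  RInt (fun t => t ^ (2 * j) * cos t ^ (2 * n)) 0 (PI / 2).

Lemma continuous_pow_cos (p q : nat) (t : R) :
  continuous (fun t : R => t ^ q * cos t ^ p) t.
Proof. apply (ex_derive_continuous (V := R_NormedModule)); auto_derive; auto. Qed.

Lemma cos_moment_correct (n j : nat) :
  is_RInt (fun t => t ^ (2 * j) * cos t ^ (2 * n)) 0 (PI / 2) (cos_moment n j).
Proof.
apply (RInt_correct (V := R_CompleteNormedModule)).
apply (ex_RInt_continuous (V := R_CompleteNormedModule)); intros t _; apply continuous_pow_cos.
Qed.

Lemma cos_moment_0_pos (n : nat) : 0 < cos_moment n 0.
Proof.
pose proof PI_RGT_0.
apply RInt_gt_0; [lra| |intros t _; apply continuous_pow_cos].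
intros t Ht; simpl (2 * 0)%nat; rewrite pow_O, Rmult_1_l.
apply pow_lt, cos_gt_0; lra.
Qed.

Lemma cos_moment_ge0 (n j : nat) : 0 <= cos_moment n j.
Proof.
pose proof PI_RGT_0.
apply RInt_ge_0; [lra| |].
- eexists; apply cos_moment_correct.
- intros t Ht; apply Rmult_le_pos; apply pow_le; [lra|apply cos_ge_0; lra].
Qed.

(* Two integrations by parts, in the form of a single antiderivative. *)
Lemma is_RInt_by_parts_cos (p q : nat) :
  is_RInt (fun t => (INR p + 2) * (INR p + 1) * (t ^ S (S q) * cos t ^ p)
                    - (INR p + 2) ^ 2 * (t ^ S (S q) * cos t ^ S (S p))
                    - (INR q + 2) * (INR q + 1) * (t ^ q * cos t ^ S (S p)))
    0 (PI / 2) 0.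
Proof.
set (F := fun t => - (INR p + 2) * (t ^ S (S q) * cos t ^ S p * sin t)
                   - (INR q + 2) * (t ^ S q * cos t ^ S (S p))).
replace 0 with (minus (F (PI / 2)) (F 0)) at 2.
2:{ unfold F; rewrite cos_PI2; change minus with Rminus; simpl; eqR; ring. }
apply (is_RInt_derive (V := R_CompleteNormedModule)).
- intros t _; unfold F; auto_derive; auto.
  pose proof (sin2_cos2 t) as H; unfold Rsqr in H.
  change (match q with O => 1 | S _ => INR q + 1 end) with (INR (S q)).
  change (match p with O => 1 | S _ => INR p + 1 end) with (INR (S p)).
  rewrite !S_INR; cbn [pow].
  (* Multiplying by [sin^2 + cos^2 = 1] makes the two sides equal as polynomials in [t], [sin t],
     [cos t]. *)
  replace ((INR p + 2) * (INR p + 1) * (t * (t * t ^ q) * cos t ^ p)) with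
    ((INR p + 2) * (INR p + 1) * (t * (t * t ^ q) * cos t ^ p) * (sin t * sin t + cos t * cos t))
    by (rewrite H; ring).
  eqR; ring.
- intros t _; apply (ex_derive_continuous (V := R_NormedModule)); auto_derive; auto.
Qed.

(** Wallis' recurrence. The previous lemma carries a factor [t^(q+2)], so this case has its own
    antiderivative [- cos^(2n+1) t sin t], zero at both ends. *)
Lemma cos_moment_0_step (n : nat) :
  (2 * INR n + 1) * cos_moment n 0 = (2 * INR n + 2) * cos_moment (S n) 0.
Proof.
assert (H : is_RInt (fun t => (2 * INR n + 1) * (t ^ (2 * 0) * cos t ^ (2 * n))
                    - (2 * INR n + 2) * (t ^ (2 * 0) * cos t ^ (2 * S n))) 0 (PI / 2) 0).
{ set (F := fun t => - (cos t ^ S (2 * n) * sin t)).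
  replace 0 with (minus (F (PI / 2)) (F 0)) at 2.
  2:{ unfold F; rewrite cos_PI2, sin_0; change minus with Rminus; simpl; eqR; ring. }
  apply (is_RInt_derive (V := R_CompleteNormedModule)).
  - intros t _; unfold F; auto_derive; auto.
    pose proof (sin2_cos2 t) as H; unfold Rsqr in H.
    replace (2 * S n)%nat with (S (S (2 * n))) by lia.
    change (n + (n + 0))%nat with (2 * n)%nat.
    change (match (2 * n)%nat with O => 1 | S _ => INR (2 * n) + 1 end) with (INR (S (2 * n))).
    rewrite S_INR, mult_INR; change (INR 2) with 2; change (2 * 0)%nat with 0%nat; cbn [pow].
    replace ((2 * INR n + 1) * (1 * cos t ^ (2 * n))) with
      ((2 * INR n + 1) * cos t ^ (2 * n) * (sin t * sin t + cos t * cos t))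
      by (rewrite H; ring).
    eqR; ring.
  - intros t _; apply (ex_derive_continuous (V := R_NormedModule)); auto_derive; auto. }
pose proof (is_RInt_minus (V := R_NormedModule) _ _ _ _ _ _
  (is_RInt_scal (V := R_NormedModule) _ _ _ (2 * INR n + 1) _ (cos_moment_correct n 0))
  (is_RInt_scal (V := R_NormedModule) _ _ _ (2 * INR n + 2) _ (cos_moment_correct (S n) 0))) as H'.
assert (E : (2 * INR n + 1) * cos_moment n 0 - (2 * INR n + 2) * cos_moment (S n) 0 = 0).
{ etransitivity; [symmetry; exact (is_RInt_unique _ _ _ _ H')|exact (is_RInt_unique _ _ _ _ H)]. }
lra.
Qed.

Lemma cos_moment_step (n j : nat) :
  (2 * INR n + 2) * (2 * INR n + 1) * cos_moment n (S j)
  = (2 * INR n + 2) ^ 2 * cos_moment (S n) (S j)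
    + (2 * INR j + 2) * (2 * INR j + 1) * cos_moment (S n) j.
Proof.
pose proof (is_RInt_by_parts_cos (2 * n) (2 * j)) as H.
replace (S (S (2 * j))) with (2 * S j)%nat in H by lia.
replace (S (S (2 * n))) with (2 * S n)%nat in H by lia.
rewrite !mult_INR in H; change (INR 2) with 2 in H.
pose proof (is_RInt_minus (V := R_NormedModule) _ _ _ _ _ _ (is_RInt_minus (V := R_NormedModule) _ _ _ _ _ _
  (is_RInt_scal (V := R_NormedModule) _ _ _ ((2 * INR n + 2) * (2 * INR n + 1)) _ (cos_moment_correct n (S j)))
  (is_RInt_scal (V := R_NormedModule) _ _ _ ((2 * INR n + 2) ^ 2) _ (cos_moment_correct (S n) (S j))))
  (is_RInt_scal (V := R_NormedModule) _ _ _ ((2 * INR j + 2) * (2 * INR j + 1)) _ (cos_moment_correct (S n) j))) as H'.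
assert (E : (2 * INR n + 2) * (2 * INR n + 1) * cos_moment n (S j)
  - (2 * INR n + 2) ^ 2 * cos_moment (S n) (S j)
  - (2 * INR j + 2) * (2 * INR j + 1) * cos_moment (S n) j = 0).
{ etransitivity; [symmetry; exact (is_RInt_unique _ _ _ _ H')|exact (is_RInt_unique _ _ _ _ H)]. }
lra.
Qed.

(** This is [t <= tan t] in a form valid up to [PI / 2]: [sin x - x cos x] vanishes at 0 and has
    derivative [x sin x >= 0]. *)
Lemma mul_cos_le_sin (t : R) : 0 <= t <= PI / 2 -> 0 <= t * cos t <= sin t.
Proof.
intros Ht; pose proof PI_RGT_0; split.
{ apply Rmult_le_pos; [lra|apply cos_ge_0; lra]. }
destruct (Req_dec t 0) as [->|Ht0]; [rewrite sin_0; lra|].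
destruct (MVT_cor2 (fun x => sin x - x * cos x) (fun x => x * sin x) 0 t) as [c [Hc Hc']]; [lra| |].
- intros c Hc; apply is_derive_Reals; auto_derive; auto; ring.
- rewrite sin_0 in Hc.
  assert (0 <= sin c) by (apply sin_ge_0; lra).
  assert (0 <= c * sin c * (t - 0)) by (apply Rmult_le_pos; [apply Rmult_le_pos|]; lra).
  lra.
Qed.

(** Two powers of [t] and two cosines are traded for [sin^2 t] and the other powers of [t] are
    bounded by those of [PI / 2]. What remains is [cos^(2n) - cos^(2n+2)], whose integral follows
    from Wallis' recurrence. *)
Lemma cos_moment_bound (n j : nat) :
  cos_moment (S n) (S j) <= (PI / 2) ^ (2 * j) * cos_moment (S n) 0 / (2 * INR n + 1).
Proof.
pose proof PI_RGT_0; pose proof (pos_INR n).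
pose proof (is_RInt_scal (V := R_NormedModule) _ _ _ ((PI / 2) ^ (2 * j)) _
  (is_RInt_minus (V := R_NormedModule) _ _ _ _ _ _ (cos_moment_correct n 0) (cos_moment_correct (S n) 0))) as H1.
replace ((PI / 2) ^ (2 * j) * cos_moment (S n) 0 / (2 * INR n + 1))
  with ((PI / 2) ^ (2 * j) * (cos_moment n 0 - cos_moment (S n) 0)).
2:{ pose proof (cos_moment_0_step n) as E.
  replace (cos_moment n 0) with ((2 * INR n + 2) * cos_moment (S n) 0 / (2 * INR n + 1))
    by (rewrite <- E; field; lra).
  field; lra. }
refine (is_RInt_le _ _ _ _ _ _ _ (cos_moment_correct (S n) (S j)) H1 _); [lra|].
intros t Ht; change (scal ?a (minus ?b ?c)) with (a * (b - c)).
destruct (mul_cos_le_sin t) as [L U]; [lra|].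
pose proof (sin2_cos2 t) as S2; unfold Rsqr in S2.
replace (2 * S j)%nat with (2 * j + 2)%nat by lia.
replace (2 * S n)%nat with (2 * n + 2)%nat by lia.
rewrite !pow_add, pow_O, !Rmult_1_l.
replace (t ^ (2 * j) * t ^ 2 * (cos t ^ (2 * n) * cos t ^ 2))
  with (t ^ (2 * j) * (cos t ^ (2 * n) * (t * cos t) ^ 2)) by ring.
replace (cos t ^ (2 * n) - cos t ^ (2 * n) * cos t ^ 2) with (cos t ^ (2 * n) * sin t ^ 2).
2:{ replace (sin t ^ 2) with (1 - cos t ^ 2) by (simpl; lra); ring. }
assert (0 <= cos t ^ (2 * n)) by (apply pow_le, cos_ge_0; lra).
assert ((t * cos t) ^ 2 <= sin t ^ 2) by (apply pow_incr; lra).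
apply Rmult_le_compat; [apply pow_le; lra| |apply pow_incr; lra|].
- apply Rmult_le_pos; [auto|apply pow_le; lra].
- apply Rmult_le_compat_l; auto.
Qed.

(** * Normalized moments and the values of [zeta({2}_m)] *)

Definition normalized_moment (n j : nat) : R :=
  4 ^ j / INR (fact (2 * j)) * (cos_moment n j / cos_moment n 0).

Lemma normalized_moment_ge0 (n j : nat) : 0 <= normalized_moment n j.
Proof.
pose proof (INR_fact_lt_0 (2 * j)).
apply Rmult_le_pos; apply Rdiv_le_0_compat; auto using cos_moment_ge0, cos_moment_0_pos.
apply pow_le; lra.
Qed.

Lemma normalized_moment_0 (n : nat) : normalized_moment n 0 = 1.
Proof.
unfold normalized_moment; pose proof (cos_moment_0_pos n); simpl; field; lra.
Qed.

(** The factorial absorbs [(2j+2)(2j+1)] from [cos_moment_step], division by the zeroth moment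
    brings in Wallis' ratio, and [4^j] turns [(2n+2)^2] into [(n+1)^2]. *)
Lemma normalized_moment_step (n j : nat) :
  normalized_moment n (S j)
  = normalized_moment (S n) (S j) + / INR (S n) ^ 2 * normalized_moment (S n) j.
Proof.
unfold normalized_moment.
pose proof (cos_moment_0_step n) as E0; pose proof (cos_moment_step n j) as E.
pose proof (cos_moment_0_pos n); pose proof (cos_moment_0_pos (S n)).
pose proof (pos_INR n); pose proof (pos_INR j); pose proof (INR_fact_neq_0 (2 * j)).
replace (2 * S j)%nat with (S (S (2 * j))) by lia.
rewrite !fact_simpl, !mult_INR, !S_INR, mult_INR; change (INR 2) with 2.
replace (cos_moment n 0) with ((2 * INR n + 2) * cos_moment (S n) 0 / (2 * INR n + 1))
    by (rewrite <- E0; field; lra).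
replace (cos_moment n (S j)) with
  (((2 * INR n + 2) ^ 2 * cos_moment (S n) (S j)
    + (2 * INR j + 2) * (2 * INR j + 1) * cos_moment (S n) j)
    / ((2 * INR n + 2) * (2 * INR n + 1))) by (rewrite <- E; field; lra).
rewrite <- tech_pow_Rmult; field; repeat split; lra.
Qed.

Lemma normalized_moment_init (j : nat) :
  normalized_moment 0 j = PI ^ (2 * j) / INR (fact (2 * j + 1)).
Proof.
pose proof PI_RGT_0.
assert (HM : forall i, cos_moment 0 i = (PI / 2) ^ (2 * i) * (PI / 2) / (2 * INR i + 1)).
{ intros i; pose proof (pos_INR i).
  set (F := fun t => t ^ S (2 * i) / (2 * INR i + 1)).
  replace ((PI / 2) ^ (2 * i) * (PI / 2) / (2 * INR i + 1)) with (minus (F (PI / 2)) (F 0)).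
  2:{ unfold F; change minus with Rminus; cbn [pow]; eqR; field; lra. }
  apply is_RInt_unique, (is_RInt_derive (V := R_CompleteNormedModule)).
  - intros t _; unfold F; auto_derive; auto.
    change (i + (i + 0))%nat with (2 * i)%nat.
    change (match (2 * i)%nat with O => 1 | S _ => INR (2 * i) + 1 end) with (INR (S (2 * i))).
    rewrite S_INR, mult_INR; change (INR 2) with 2.
    change (2 * 0)%nat with 0%nat; rewrite pow_O; eqR; field; lra.
  - intros t _; apply continuous_pow_cos. }
unfold normalized_moment; rewrite !HM.
replace (2 * j + 1)%nat with (S (2 * j)) by lia.
rewrite fact_simpl, mult_INR, S_INR, mult_INR; change (INR 2) with 2.
pose proof (pos_INR j); pose proof (INR_fact_neq_0 (2 * j)).
replace (PI ^ (2 * j)) with (4 ^ j * (PI / 2) ^ (2 * j)).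
2:{ rewrite !pow_mult, <- Rpow_mult_distr; f_equal; field. }
change (2 * 0)%nat with 0%nat; simpl (INR 0); rewrite pow_O.
field; repeat split; lra.
Qed.

Lemma normalized_moment_lim (j : nat) :
  is_lim_seq (fun n => normalized_moment n (S j)) 0.
Proof.
apply is_lim_seq_incr_1.
set (C := 4 ^ S j / INR (fact (2 * S j)) * (PI / 2) ^ (2 * j)).
apply (is_lim_seq_le_le (fun _ => 0) _ (fun n => C * / INR (S n))).
- intros n; split; [apply normalized_moment_ge0|].
  unfold normalized_moment, C; rewrite Rmult_assoc.
  pose proof (cos_moment_0_pos (S n)); pose proof (cos_moment_bound n j) as B.
  pose proof (pos_INR n); pose proof PI_RGT_0.
  apply Rmult_le_compat_l.
  { apply Rdiv_le_0_compat; [apply pow_le; lra|apply INR_fact_lt_0]. }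
  apply Rle_div_l; [auto|]; eapply Rle_trans; [exact B|].
  unfold Rdiv; rewrite !Rmult_assoc; apply Rmult_le_compat_l; [apply pow_le; lra|].
  rewrite (Rmult_comm (/ INR (S n))); apply Rmult_le_compat_l; [lra|].
  rewrite S_INR; apply Rinv_le_contravar; lra.
- apply is_lim_seq_const.
- replace (Finite 0) with (Rbar_mult C 0) by (simpl; f_equal; ring).
  apply is_lim_seq_scal_l.
  apply -> (is_lim_seq_incr_1 (fun n => / INR n)).
  apply (is_lim_seq_inv _ p_infty); [apply is_lim_seq_INR|discriminate].
Qed.

(** In [conv_transfer] the correction vanishes, as both zeroth entries are 1, so the convolution is
    constant in [n]. At [n = 0] only the term [j = s] survives. *)
Lemma conv_normalized_moment_mhs (n s : nat) :
  conv (normalized_moment n) (fun i => mhs n (twos i)) s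
  = PI ^ (2 * s) / INR (fact (2 * s + 1)).
Proof.
induction n as [|n IH].
- rewrite <- normalized_moment_init; unfold conv.
  destruct s as [|s]; [simpl; ring|].
  rewrite tech5, Nat.sub_diag; simpl (mhs 0 (twos 0)).
  rewrite sum_eq_R0; [ring|].
  intros j Hj; replace (S s - j)%nat with (S (s - j)) by lia; rewrite mhs_twos_0; ring.
- rewrite (conv_transfer (/ INR (S n) ^ 2) (fun i => mhs n (twos i)) _ (normalized_moment n)).
  + rewrite IH, !normalized_moment_0; ring.
  + reflexivity.
  + intros i; apply mhs_twos_S.
  + intros j; apply normalized_moment_step.
Qed.

Lemma sum_n_m_ge0 (u : nat -> R) (a b : nat) :
  (forall k, 0 <= u k) -> 0 <= sum_n_m u a b.
Proof.
intros H; apply Rle_trans with (sum_n_m (fun _ => 0) a b); [|apply sum_n_m_le; exact H].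
rewrite (sum_n_m_const_zero (G := R_AbelianMonoid)); apply Rle_refl.
Qed.

(** The sum is the [j = 0] term of a convolution with nonnegative terms. The bound is uniform in
    [n], as the limit below requires. *)
Lemma mhs_twos_le (n s : nat) : mhs n (twos s) <= PI ^ (2 * s) / INR (fact (2 * s + 1)).
Proof.
rewrite <- (conv_normalized_moment_mhs n), conv_split, normalized_moment_0, Rmult_1_l.
rewrite <- (Rplus_0_r (mhs n (twos s))) at 1; apply Rplus_le_compat_l, sum_n_m_ge0.
intros k; apply Rmult_le_pos; [apply normalized_moment_ge0|apply mhs_twos_ge0].
Qed.

(** Convergence is asked only from [a] on: both uses have [a = 1], and the index 0 does not follow
    the same limit formula. *)
Lemma is_lim_seq_sum_n_m (u : nat -> nat -> R) (l : nat -> R) (a b : nat) :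
  (forall j, (a <= j)%nat -> is_lim_seq (u j) (l j)) ->
  is_lim_seq (fun n => sum_n_m (fun j => u j n) a b) (sum_n_m l a b).
Proof.
intros H; induction b as [|b IH].
- destruct a as [|a].
  + rewrite sum_n_n; apply (is_lim_seq_ext (u 0%nat)); [|apply H; lia].
    intros n; now rewrite sum_n_n.
  + rewrite sum_n_m_zero by lia.
    apply (is_lim_seq_ext (fun _ => 0)); [|apply is_lim_seq_const].
    intros n; now rewrite sum_n_m_zero by lia.
- destruct (Nat.le_gt_cases a (S b)) as [Hab|Hab].
  + rewrite sum_n_Sm by lia.
    apply (is_lim_seq_ext (fun n => sum_n_m (fun j => u j n) a b + u (S b) n)).
    * intros n; now rewrite sum_n_Sm by lia.
    * apply is_lim_seq_plus'; [apply IH|apply H; lia].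
  + rewrite sum_n_m_zero by lia.
    apply (is_lim_seq_ext (fun _ => 0)); [|apply is_lim_seq_const].
    intros n; now rewrite sum_n_m_zero by lia.
Qed.

Lemma mhs_twos_lim (s : nat) :
  is_lim_seq (fun n => mhs n (twos s)) (PI ^ (2 * s) / INR (fact (2 * s + 1))).
Proof.
set (L := PI ^ (2 * s) / INR (fact (2 * s + 1))).
(* The constant convolution is solved for its [j = 0] term; every other term is a moment tending to
   0 times a bounded sum. *)
apply (is_lim_seq_ext (fun n =>
  L - sum_n_m (fun j => normalized_moment n j * mhs n (twos (s - j))) 1 s)).
{ intros n; unfold L; rewrite <- (conv_normalized_moment_mhs n), conv_split.
  rewrite normalized_moment_0; eqR; ring. }
replace (Finite L) with (Finite (L - sum_n_m (fun _ => 0) 1 s)).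
2:{ rewrite (sum_n_m_const_zero (G := R_AbelianMonoid)); f_equal; apply Rminus_0_r. }
apply is_lim_seq_minus'; [apply is_lim_seq_const|].
apply (is_lim_seq_sum_n_m
  (fun j n => normalized_moment n j * mhs n (twos (s - j))) (fun _ => 0)).
intros [|j] Hj; [lia|].
set (C := PI ^ (2 * (s - S j)) / INR (fact (2 * (s - S j) + 1))).
apply (is_lim_seq_le_le (fun _ => 0) _ (fun n => normalized_moment n (S j) * C)).
- intros n; pose proof (normalized_moment_ge0 n (S j)); split.
  + apply Rmult_le_pos; [auto|apply mhs_twos_ge0].
  + apply Rmult_le_compat_l; [auto|apply mhs_twos_le].
- apply is_lim_seq_const.
- rewrite <- (Rmult_0_l C); apply is_lim_seq_mult';
    [apply normalized_moment_lim|apply is_lim_seq_const].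
Qed.

Lemma mzv_twos (s : nat) : mzv (twos s) = PI ^ (2 * s) / INR (fact (2 * s + 1)).
Proof. unfold mzv; now rewrite (is_lim_seq_unique _ _ (mhs_twos_lim s)). Qed.

(** * Riemann zeta values and their alternating versions *)

Lemma is_series_shift (u : nat -> R) (l : R) :
  is_series (fun i => u (S i)) l <-> is_lim_seq (fun n => sum_n_m u 1 n) l.
Proof.
rewrite is_lim_seq_incr_1.
change (is_lim_seq (sum_n (fun i => u (S i))) l
        <-> is_lim_seq (fun n => sum_n_m u 1 (S n)) l).
split; apply is_lim_seq_ext; intros n; unfold sum_n; now rewrite sum_n_m_S.
Qed.

(** The case [s = 1] of [mhs_twos_lim]; it serves as the dominating series below. *)
Lemma is_series_inv_sqr : is_series (fun i => / INR (S i) ^ 2) (PI ^ 2 / 6).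
Proof.
apply (is_series_shift (fun k => / INR k ^ 2)).
replace (PI ^ 2 / 6) with (PI ^ (2 * 1) / INR (fact (2 * 1 + 1)))
  by (rewrite INR_IZR_INZ; reflexivity).
apply (is_lim_seq_ext (fun n => mhs n (twos 1))); [|apply mhs_twos_lim].
intros n; apply sum_n_m_ext; intros k; apply Rmult_1_r.
Qed.

Lemma inv_pow_INR_le (s i : nat) : (2 <= s)%nat ->
  0 <= / INR (S i) ^ s <= / INR (S i) ^ 2.
Proof.
intros Hs; assert (1 <= INR (S i)) by (apply (le_INR 1); lia); split.
- apply Rlt_le, Rinv_0_lt_compat, pow_lt; lra.
- apply Rinv_le_contravar; [apply pow_lt; lra|apply Rle_pow; auto].
Qed.

Lemma riemann_zeta_correct (s : nat) : (2 <= s)%nat ->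
  is_series (fun i => / INR (S i) ^ s) (riemann_zeta s).
Proof.
intros Hs; apply Series_correct.
apply (ex_series_le (V := R_CompleteNormedModule) _ (fun i => / INR (S i) ^ 2)).
- intros i; destruct (inv_pow_INR_le s i Hs).
  change (norm ?x) with (Rabs x); now rewrite Rabs_pos_eq.
- eexists; apply is_series_inv_sqr.
Qed.

(** The alternating sum is the full sum minus twice its even-indexed terms, and
    [2 / 2^(s+1) = 1 / 2^s]. *)
Lemma alternating_partial_sum_even (s n : nat) :
  sum_n_m (fun k => - (-1) ^ k / INR k ^ S s) 1 (2 * n)
  = sum_n_m (fun k => / INR k ^ S s) 1 (2 * n)
    - / 2 ^ s * sum_n_m (fun k => / INR k ^ S s) 1 n.
Proof.
induction n as [|n IH].
- rewrite !sum_n_m_zero by lia; change (zero (G := R_AbelianMonoid)) with 0; eqR; ring.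
- replace (2 * S n)%nat with (S (S (2 * n))) by lia.
  rewrite !(sum_n_Sm _ 1) by lia; rewrite IH; change plus with Rplus.
  replace (S (S (2 * n))) with (2 * S n)%nat by lia.
  rewrite (pow_1_even (S n)), pow_1_odd.
  replace (INR (2 * S n) ^ S s) with (2 * 2 ^ s * INR (S n) ^ S s)
    by (rewrite mult_INR, Rpow_mult_distr; reflexivity).
  assert (INR (S n) ^ S s <> 0) by (apply pow_nonzero, not_0_INR; lia).
  assert (INR (S (2 * n)) ^ S s <> 0) by (apply pow_nonzero, not_0_INR; lia).
  assert (2 ^ s <> 0) by (apply pow_nonzero; lra).
  eqR; field; auto.
Qed.

Lemma alternating_zeta_lim (s : nat) : (1 <= s)%nat ->
  is_lim_seq (fun n => sum_n_m (fun k => - (-1) ^ k / INR k ^ S s) 1 n)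
    ((1 - / 2 ^ s) * riemann_zeta (S s)).
Proof.
intros Hs; set (u := fun k => - (-1) ^ k / INR k ^ S s).
assert (Hz := proj1 (is_series_shift (fun k => / INR k ^ S s) _)
                (riemann_zeta_correct (S s) ltac:(lia))).
assert (Hex : ex_series (fun i => u (S i))).
{ apply (ex_series_le (V := R_CompleteNormedModule) _ (fun i => / INR (S i) ^ 2)).
  - intros i; destruct (inv_pow_INR_le (S s) i) as [L U]; [lia|].
    change (norm ?x) with (Rabs x); unfold u, Rdiv.
    rewrite Rabs_mult, Rabs_Ropp, pow_1_abs, Rmult_1_l, Rabs_pos_eq; auto.
  - eexists; apply is_series_inv_sqr. }
destruct Hex as [l Hl]; apply is_series_shift in Hl.
replace ((1 - / 2 ^ s) * riemann_zeta (S s)) with l; [exact Hl|].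
(* Absolute convergence has provided a limit [l]; its value is read off along even indices. *)
assert (D : filterlim (fun n => (2 * n)%nat) eventually eventually)
  by (apply eventually_subseq; intros n; lia).
pose proof (is_lim_seq_subseq _ _ _ D Hl) as H1.
pose proof (is_lim_seq_subseq _ _ _ D Hz) as H2.
pose proof (is_lim_seq_minus' _ _ _ _ H2 (is_lim_seq_scal_l _ (/ 2 ^ s) _ Hz)) as H3.
apply (is_lim_seq_ext _ (fun n => sum_n_m u 1 (2 * n))) in H3.
2:{ intros n; symmetry; apply alternating_partial_sum_even. }
apply is_lim_seq_unique in H1; apply is_lim_seq_unique in H3.
rewrite H1 in H3; injection H3 as H3; rewrite H3; eqR; ring.
Qed.

(** * Removing the damping in the limit *)

(* [1 - rho <= min 1 (k^2 / n) <= k / sqrt n], which leaves a convergent sum over [k]. *)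
Lemma rho_defect (n k : nat) : (0 < n)%nat -> (k <= n)%nat ->
  0 <= 1 - rho (INR n) k <= INR k / sqrt (INR n).
Proof.
intros Hn Hk; destruct (rho_bounds n k Hn Hk) as [[H0 H1] H2]; split; [lra|].
apply lt_0_INR in Hn; pose proof (sqrt_lt_R0 _ Hn) as Hs.
pose proof (sqrt_sqrt (INR n) ltac:(lra)) as Hss.
set (x := INR k / sqrt (INR n)).
assert (Hx : INR k ^ 2 / INR n = x ^ 2).
{ unfold x; rewrite <- Hss at 1; field; lra. }
assert (0 <= x) by (apply Rdiv_le_0_compat; [apply pos_INR|auto]).
rewrite Hx in H2; destruct (Rle_dec x 1); nra.
Qed.

Lemma sum_n_m_le_loc (u v : nat -> R) (a b : nat) :
  (forall k, (a <= k <= b)%nat -> u k <= v k) -> sum_n_m u a b <= sum_n_m v a b.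
Proof.
intros H.
(* [sum_n_m_le] compares at every index; the minimum agrees with [u] on the range and is below [v]
   everywhere. *)
rewrite (sum_n_m_ext_loc u (fun k => Rmin (u k) (v k))).
- apply sum_n_m_le; intros k; apply Rmin_r.
- intros k Hk; symmetry; apply Rmin_left, H, Hk.
Qed.

Lemma eta_approx_error (n j : nat) : (0 < n)%nat ->
  Rabs (eta_approx n (S j) - sum_n_m (fun k => - (-1) ^ k / INR k ^ S (2 * S j)) 1 n)
  <= PI ^ 2 / 6 / sqrt (INR n).
Proof.
intros Hn; pose proof (sqrt_lt_R0 _ (lt_0_INR _ Hn)) as Hs.
replace (eta_approx n (S j) - sum_n_m (fun k => - (-1) ^ k / INR k ^ S (2 * S j)) 1 n)
  with (sum_n_m (fun k => - (-1) ^ k * rho (INR n) k / INR k ^ S (2 * S j)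
                   + (-1) * (- (-1) ^ k / INR k ^ S (2 * S j))) 1 n).
2:{ rewrite sum_n_m_lin; unfold eta_approx.
    replace (2 * S j + 1)%nat with (S (2 * S j)) by lia; eqR; ring. }
apply Rle_trans with (sum_n_m (fun k => / sqrt (INR n) * / INR k ^ 2) 1 n).
- eapply Rle_trans; [apply (norm_sum_n_m (V := R_NormedModule))|].
  apply sum_n_m_le_loc; intros k Hk; change (norm ?x) with (Rabs x).
  destruct (rho_defect n k Hn) as [D0 D1]; [lia|].
  assert (Hk0 : 1 <= INR k) by (apply (le_INR 1); lia).
  assert (Hp : 0 < / INR k ^ S (2 * S j)) by (apply Rinv_0_lt_compat, pow_lt; lra).
  replace (- (-1) ^ k * rho (INR n) k / INR k ^ S (2 * S j)
           + -1 * (- (-1) ^ k / INR k ^ S (2 * S j)))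
    with ((-1) ^ k * ((1 - rho (INR n) k) * / INR k ^ S (2 * S j)))
    by (unfold Rdiv; ring).
  rewrite Rabs_mult, pow_1_abs, Rmult_1_l, Rabs_pos_eq by (apply Rmult_le_pos; lra).
  apply Rle_trans with (INR k / sqrt (INR n) * / INR k ^ 3).
  + apply Rmult_le_compat; [lra|lra|exact D1|].
    apply Rinv_le_contravar; [apply pow_lt; lra|apply Rle_pow; [auto|lia]].
  + apply Req_le; field; lra.
- rewrite (sum_n_m_mult_l (K := R_Ring)); change mult with Rmult.
  rewrite Rmult_comm; apply Rmult_le_compat_r; [apply Rlt_le, Rinv_0_lt_compat; auto|].
  apply (is_lim_seq_incr_compare (fun n => sum_n_m (fun k => / INR k ^ 2) 1 n)).
  + apply is_series_shift, is_series_inv_sqr.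
  + intros m; rewrite sum_n_Sm by lia.
    rewrite <- (Rplus_0_r (sum_n_m _ _ _)) at 1; apply Rplus_le_compat_l.
    apply Rlt_le, Rinv_0_lt_compat, pow_lt, lt_0_INR; lia.
Qed.

Lemma eta_approx_lim (j : nat) :
  is_lim_seq (fun n => eta_approx n (S j)) ((1 - / 4 ^ S j) * riemann_zeta (2 * S j + 1)).
Proof.
set (A := fun n => sum_n_m (fun k => - (-1) ^ k / INR k ^ S (2 * S j)) 1 n).
apply (is_lim_seq_ext (fun n => A n + (eta_approx n (S j) - A n))); [intros n; ring|].
rewrite <- (Rplus_0_r (_ * _)); apply is_lim_seq_plus'.
{ replace (4 ^ S j) with (2 ^ (2 * S j)) by (rewrite pow_mult; f_equal; ring).
  replace (2 * S j + 1)%nat with (S (2 * S j)) by lia.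
  apply alternating_zeta_lim; lia. }
apply is_lim_seq_abs_0.
apply (is_lim_seq_le_le_loc (fun _ => 0) _ (fun n => PI ^ 2 / 6 * / sqrt (INR n))).
- exists 1%nat; intros n Hn; split; [apply Rabs_pos|apply eta_approx_error; lia].
- apply is_lim_seq_const.
- replace (Finite 0) with (Rbar_mult (PI ^ 2 / 6) 0) by (simpl; f_equal; ring).
  apply is_lim_seq_scal_l, (is_lim_seq_inv _ p_infty); [|discriminate].
  apply (filterlim_comp _ _ _ INR sqrt _ (Rbar_locally p_infty));
    [apply is_lim_seq_INR|apply filterlim_sqrt_p].
Qed.

Theorem theorem3p1 (r : nat) (hr : (1 <= r)%nat) :
  is_series
    (fun i : nat =>
       let n := S i in
       Hbar (2 * n) * mhs (n - 1) (twos (r - 1)) / INR n ^ 2)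
    (sum_n_m
       (fun j : nat =>
          (-1) ^ j * (1 - / 4 ^ j) * mzv (twos (r - j))
          * riemann_zeta (2 * j + 1))
       1 r)
  /\ (forall m : nat, (1 <= m)%nat ->
        mzv (twos m) = PI ^ (2 * m) / INR (fact (2 * m + 1)))
  /\ mzv (twos 0) = 1.
Proof.
split; [|split].
- destruct r as [|r]; [lia|]; replace (S r - 1)%nat with r by lia.
  apply (is_series_shift (fun k => Hbar (2 * k) * mhs (k - 1) (twos r) / INR k ^ 2)).
  (* The closed form has a number of terms independent of [n], so the limit is taken term by
     term. *)
  apply (is_lim_seq_ext (fun n =>
    sum_n_m (fun j => (-1) ^ j * eta_approx n j * mhs n (twos (S r - j))) 1 (S r))).
  { intros n; symmetry; apply partial_sum_closed_form. }
  apply (is_lim_seq_sum_n_m (fun j n => (-1) ^ j * eta_approx n j * mhs n (twos (S r - j)))).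
  intros [|j] Hj; [lia|].
  replace ((-1) ^ S j * (1 - / 4 ^ S j) * mzv (twos (S r - S j)) * riemann_zeta (2 * S j + 1))
    with ((-1) ^ S j * ((1 - / 4 ^ S j) * riemann_zeta (2 * S j + 1)) * mzv (twos (S r - S j)))
    by ring.
  apply is_lim_seq_mult'; [|rewrite mzv_twos; apply mhs_twos_lim].
  apply is_lim_seq_mult'; [apply is_lim_seq_const|apply eta_approx_lim].
- intros m _; apply mzv_twos.
- rewrite mzv_twos; simpl; field.
Qed.
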